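(* Let $0\le p\le1$ and let $\Gamma$ be the amplitude damping channel on a single qubit, with Kraus operators $K_0=|0\rangle\langle0|+\sqrt{1-p}\,|1\rangle\langle1|$, $K_1=\sqrt{p}\,|0\rangle\langle1|$. If $M_{l_1}$ is taken as the measure of imaginarity, then the quantum state order does not change after a single qubit goes through the amplitude damping channel; that is, for arbitrary qubit states $\rho_1,\rho_2$, $$M_{l_1}(\rho_1)\le M_{l_1}(\rho_2)\iff M_{l_1}(\Gamma(\rho_1))\le M_{l_1}(\Gamma(\rho_2)).$$
   Context: Fix the basis $\{|0\rangle,|1\rangle\}$ of the qubit space $\mathbb{C}^2$. The channel acts by $\Gamma(\rho)=K_0\rho K_0^\dagger+K_1\rho K_1^\dagger$. $\mathcal{F}$ is the set of density matrices with all real entries in this basis, and $M_{l_1}(\rho)=\min_{\sigma\in\mathcal{F}}\|\rho-\sigma\|_{l_1}=\sum_{i\ne j}|\mathrm{Im}(\rho_{ij})|$, where $\|A\|_{l_1}=\sum_{ij}|A_{ij}|$. A channel $\Gamma$ does not change the quantum state order for a measure $M$ if $M(\rho_1)\le M(\rho_2)\Leftrightarrow M(\Gamma(\rho_1))\le M(\Gamma(\rho_2))$ for arbitrary two states $\rho_1,\rho_2$.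
   Formalization: The case p = 1 is excluded: there the channel sends every state to |0><0|, so the equivalence fails, e.g. for ρ1 = ½[[1,i],[−i,1]] and ρ2 = |0><0|; the claim is proved for all 0 ≤ p < 1. *)

(* Defs.v *)
From HB Require Import structures.
From mathcomp Require Import all_boot all_order all_algebra.
From mathcomp Require Import sesquilinear spectral complex.
From mathcomp Require Import classical_sets reals.

Set Implicit Arguments.
Unset Strict Implicit.
Unset Printing Implicit Defensive.

Import Order.TTheory GRing.Theory Num.Theory.

Local Open Scope ring_scope.
Local Open Scope sesquilinear_scope.
Local Open Scope complex_scope.

(* In the order of R[i], 0 <= z means that z is real and nonnegative. *)
Definition is_density (R : realType) (n : nat) (rho : 'M[R[i]]_n) : Prop :=
  [/\ rho ^t* = rho,
      forall v : 'cV[R[i]]_n, 0 <= (v ^t* *m rho *m v) 0 0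
    & \tr rho = 1].

(* The free set F of the resource theory of imaginarity. *)
Definition is_real_density (R : realType) (n : nat) (rho : 'M[R[i]]_n) : Prop :=
  is_density rho /\ forall i j, rho i j \is Num.real.

Definition l1norm (R : realType) (n : nat) (A : 'M[R[i]]_n) : R :=
  \sum_(i < n) \sum_(j < n) Normc.normc (A i j).

(* The minimum over F, written as an infimum. For a density matrix it is
   attained, at the entrywise real part. *)
Definition imaginarity_l1 (R : realType) (n : nat) (rho : 'M[R[i]]_n) : R :=
  inf [set l1norm (rho - sigma) | sigma in [set s | is_real_density s]].

Definition ket (R : realType) (n : nat) (i : 'I_n) : 'cV[R[i]]_n :=
  delta_mx i 0.

Definition ketbra (R : realType) (n : nat) (i j : 'I_n) : 'M[R[i]]_n :=
  ket R i *m (ket R j) ^t*.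

Definition amp_damp_K0 (R : realType) (p : R) : 'M[R[i]]_2 :=
  ketbra R 0 0 + (Num.sqrt (1 - p))%:C *: ketbra R 1 1.

Definition amp_damp_K1 (R : realType) (p : R) : 'M[R[i]]_2 :=
  (Num.sqrt p)%:C *: ketbra R 0 1.

Definition amplitude_damping (R : realType) (p : R) (rho : 'M[R[i]]_2)
    : 'M[R[i]]_2 :=
  amp_damp_K0 p *m rho *m (amp_damp_K0 p) ^t*
  + amp_damp_K1 p *m rho *m (amp_damp_K1 p) ^t*.

Definition preserves_state_order (R : realType) (n : nat)
    (M : 'M[R[i]]_n -> R) (Gamma : 'M[R[i]]_n -> 'M[R[i]]_n) : Prop :=
  forall rho1 rho2 : 'M[R[i]]_n, is_density rho1 -> is_density rho2 ->
    (M rho1 <= M rho2 <-> M (Gamma rho1) <= M (Gamma rho2)).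

(* Main.v *)
(* The entrywise real part of a density matrix is the average of that matrix and
   its conjugate, hence a density matrix; it is the closest real one, so the
   imaginarity of rho is the sum of the |Im (rho i j)|. The diagonal of rho is
   real and the channel scales the off-diagonal entries by sqrt (1 - p), so it
   scales the imaginarity by this factor, which is positive as p < 1. *)
Require Import Defs.
From mathcomp Require Import all_boot all_order all_algebra reals.
From mathcomp Require Import sesquilinear spectral complex classical_sets ring.

Import Order.TTheory GRing.Theory Num.Theory.

Local Open Scope ring_scope.
Local Open Scope sesquilinear_scope.
Local Open Scope complex_scope.

Lemma adjmxM (C : numClosedFieldType) (m n k : nat)
    (A : 'M[C]_(m, n)) (B : 'M[C]_(n, k)) :
  (A *m B) ^t* = B ^t* *m A ^t*.
Proof. by rewrite trmx_mul map_mxM. Qed.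

Lemma adjmxD (C : numClosedFieldType) (m n : nat) (A B : 'M[C]_(m, n)) :
  (A + B) ^t* = A ^t* + B ^t*.
Proof. by rewrite linearD map_mxD. Qed.

Lemma adjmxZ (C : numClosedFieldType) (m n : nat) (a : C) (A : 'M[C]_(m, n)) :
  (a *: A) ^t* = a^*%R *: A ^t*.
Proof. by rewrite linearZ map_mxZ. Qed.

(** The quadratic form of the conjugate matrix at [v] is the conjugate of the form of [rho] at the
    conjugate of [v], and conjugation fixes nonnegative reals. *)
Lemma conjmx_density (R : realType) (n : nat) (rho : 'M[R[i]]_n) :
  is_density rho -> is_density (map_mx Num.conj rho).
Proof.
case=> herm pos tr1; split.
- by rewrite -{2}herm map_trmx.
- move=> v; have := pos (map_mx Num.conj v); rewrite -conjC_ge0.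
  congr (0 <= _).
  have -> : v ^t* *m map_mx Num.conj rho *m v
      = map_mx Num.conj ((map_mx Num.conj v) ^t* *m rho *m map_mx Num.conj v).
    rewrite !map_mxM; congr (_ *m _ *m _).
    + by apply/matrixP=> i j; rewrite !mxE conjCK.
    + by apply/matrixP=> i j; rewrite !mxE; apply/esym/conjCK.
  by rewrite [RHS]mxE.
- by rewrite trace_map_mx tr1 rmorph1.
Qed.

Definition Remx {R : realType} {n : nat} (rho : 'M[R[i]]_n) : 'M[R[i]]_n :=
  map_mx (fun z => (complex.Re z)%:C) rho.

Lemma RemxE (R : realType) (n : nat) (rho : 'M[R[i]]_n) :
  Remx rho = 2^-1 *: (rho + map_mx Num.conj rho).
Proof. by apply/matrixP=> i j; rewrite !mxE complexRe ReE mulrC. Qed.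

Lemma Remx_real_density (R : realType) (n : nat) (rho : 'M[R[i]]_n) :
  is_density rho -> is_real_density (Remx rho).
Proof.
move=> D; have [herm' pos' tr1'] := conjmx_density _ _ _ D.
case: D => herm pos tr1; split; last first.
  by move=> i j; rewrite mxE; apply/complex_realP; exists (complex.Re (rho i j)).
rewrite RemxE; split.
- by rewrite adjmxZ adjmxD herm herm' fmorphV rmorph_nat.
- move=> v; rewrite -scalemxAr -scalemxAl mulmxDr mulmxDl mxE [X in _ * X]mxE.
  by rewrite mulr_ge0 ?invr_ge0 ?ler0n// addr_ge0.
- by rewrite mxtraceZ mxtraceD tr1 tr1' -(natrD _ 1 1) mulVf ?pnatr_eq0.
Qed.

Lemma normc_ge_Im (R : realType) (z : R[i]) : `|complex.Im z| <= Normc.normc z.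
Proof.
by case: z => a b /=; rewrite -sqrtr_sqr ler_wsqrtr// lerDr sqr_ge0.
Qed.

Lemma normc_subRe (R : realType) (z : R[i]) :
  Normc.normc (z - (complex.Re z)%:C) = `|complex.Im z|.
Proof.
by case: z => a b /=; rewrite subrr subr0 expr0n add0r sqrtr_sqr.
Qed.

Lemma imaginarity_l1E (R : realType) (n : nat) (rho : 'M[R[i]]_n) :
  is_density rho ->
  imaginarity_l1 rho = \sum_(i < n) \sum_(j < n) `|complex.Im (rho i j)|.
Proof.
move=> D; apply/eqP; rewrite eq_le; apply/andP.
pose E : set R :=
  [set l1norm (rho - sigma) | sigma in [set s | is_real_density s]]%classic.
(* Subtracting a real entry leaves the imaginary part unchanged, and a modulus is at least the
   absolute imaginary part. *)
have lb : lbound E (\sum_(i < n) \sum_(j < n) `|complex.Im (rho i j)|).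
  move=> _ [sigma [_ sR] <-]; apply: ler_sum => i _; apply: ler_sum => j _.
  apply: le_trans (normc_ge_Im _ _); rewrite !mxE.
  by have /complex_realP[k ->] := sR i j; case: (rho i j) => a b /=; rewrite subr0.
have mem : E (\sum_(i < n) \sum_(j < n) `|complex.Im (rho i j)|).
  exists (Remx rho); first exact: Remx_real_density.
  by apply: eq_bigr => i _; apply: eq_bigr => j _; rewrite !mxE normc_subRe.
(* The bound is itself a member of [E], so it is the infimum. [lb] and [mem] also show that [E] is
   bounded below and nonempty, so [inf] is not a default value. *)
split; first by apply: ge_inf => //; eexists; exact: lb.
by apply: lb_le_inf => //; eexists; exact: mem.
Qed.

Lemma Im_density_diag (R : realType) (n : nat) (rho : 'M[R[i]]_n) (i : 'I_n) :
  is_density rho -> complex.Im (rho i i) = 0.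
Proof.
case=> herm _ _; have /complex_realP[x ->//] : rho i i \is Num.real.
by apply/CrealP; rewrite -{2}herm !mxE.
Qed.

(** Each term's form at [v] is that of [rho] at [A ^t* *m v] or [B ^t* *m v]. Cyclicity of the trace
    gathers the Kraus operators into the sum assumed to be the identity. *)
Lemma kraus2_density (R : realType) (n : nat) (A B rho : 'M[R[i]]_n) :
  A ^t* *m A + B ^t* *m B = 1%:M -> is_density rho ->
  is_density (A *m rho *m A ^t* + B *m rho *m B ^t*).
Proof.
move=> AB1 [herm pos tr1]; split.
- by rewrite adjmxD !adjmxM !trmxCK herm !mulmxA.
- move=> v; rewrite mulmxDr mulmxDl mxE addr_ge0//.
  + by have := pos (A ^t* *m v); rewrite adjmxM trmxCK !mulmxA.
  + by have := pos (B ^t* *m v); rewrite adjmxM trmxCK !mulmxA.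
- rewrite mxtraceD -!(mulmxA _ rho) ![\tr (_ *m (rho *m _))]mxtrace_mulC.
  by rewrite -!mulmxA -mxtraceD -mulmxDr AB1 mulmx1.
Qed.

Lemma ketbraE (R : realType) (n : nat) (i j : 'I_n) :
  ketbra R i j = delta_mx i j.
Proof.
rewrite /ketbra /ket; apply/matrixP=> k l; rewrite !mxE big_ord1 !mxE !andbT.
by rewrite rmorph_nat -natrM mulnb.
Qed.

Lemma conj_realc (R : rcfType) (x : R) : (x%:C^*)%R = x%:C.
Proof. exact: conjc_real. Qed.

Lemma ord2P (k : 'I_2) : k = 0 \/ k = 1.
Proof. by case: k => [[|[|//]] lt]; [left|right]; apply/val_inj. Qed.

Lemma matrix2P (C : Type) (A B : 'M[C]_2) :
  A 0 0 = B 0 0 -> A 0 1 = B 0 1 -> A 1 0 = B 1 0 -> A 1 1 = B 1 1 -> A = B.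
Proof.
move=> h00 h01 h10 h11; apply/matrixP=> i j.
by case: (ord2P i) => ->; case: (ord2P j) => ->.
Qed.

Lemma amp_damp_complete (R : realType) (p : R) : 0 <= p <= 1 ->
  (amp_damp_K0 p) ^t* *m amp_damp_K0 p + (amp_damp_K1 p) ^t* *m amp_damp_K1 p
  = 1%:M.
Proof.
move=> /andP[p0 p1]; rewrite /amp_damp_K0 /amp_damp_K1 !ketbraE.
apply: matrix2P; rewrite !mxE !big_ord_recl !big_ord0 !mxE /=.
all: rewrite ?(mulr0, mulr1, add0r, addr0) ?(conjC0, conjC1, conj_realc).
all: rewrite ?(mulr0, mul0r, mulr1, addr0)//.
(* Only the entry (1,1) remains, where the two squared roots give [(1 - p) + p]. *)
rewrite -!rmorphM -rmorphD -!expr2 !sqr_sqrtr ?subr_ge0// subrK.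
by rewrite rmorph1.
Qed.

Lemma Im_amplitude_damping (R : realType) (p : R) (rho : 'M[R[i]]_2)
    (i j : 'I_2) :
  is_density rho ->
  complex.Im (amplitude_damping p rho i j)
  = Num.sqrt (1 - p) * complex.Im (rho i j).
Proof.
move=> D; have diag k := Im_density_diag _ _ _ k D.
rewrite /amplitude_damping /amp_damp_K0 /amp_damp_K1 !ketbraE.
have l01 : lift ord0 ord0 = 1 :> 'I_2 by apply/val_inj.
case: (ord2P i) => ->; case: (ord2P j) => ->.
all: rewrite !mxE !big_ord_recl !big_ord0 !mxE !big_ord_recl !big_ord0 !mxE /=.
all: rewrite ?(mulr0, mul0r, mulr1, mul1r, add0r, addr0).
all: rewrite ?(conjC0, conjC1, conj_realc) ?(mulr0, mul0r, mulr1, addr0) ?l01.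
(* The diagonal outputs are [rho 0 0 + p * rho 1 1] and [(1 - p) * rho 1 1], with zero imaginary
   part on both sides of the equation. Off the diagonal only [amp_damp_K0] contributes, with one
   factor [sqrt (1 - p)]. *)
- move: (diag 0) (diag 1); case: (rho 0 0) => a b; case: (rho 1 1) => c d /=.
  by move=> -> ->; ring.
- by case: (rho 0 1) => a b /=; ring.
- by case: (rho 1 0) => a b /=; ring.
- by move: (diag 1); case: (rho 1 1) => a b /= ->; ring.
Qed.

Lemma imaginarity_l1_amplitude_damping (R : realType) (p : R)
    (rho : 'M[R[i]]_2) :
  0 <= p <= 1 -> is_density rho ->
  imaginarity_l1 (amplitude_damping p rho)
  = Num.sqrt (1 - p) * imaginarity_l1 rho.
Proof.
move=> hp D; rewrite !imaginarity_l1E//; last first.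
  (* The closed formula for the imaginarity holds for density matrices, so the channel output must
     be shown to be one. *)
  by apply: kraus2_density => //; apply: amp_damp_complete.
rewrite mulr_sumr; apply: eq_bigr => i _.
rewrite mulr_sumr; apply: eq_bigr => j _.
by rewrite Im_amplitude_damping// normrM ger0_norm ?sqrtr_ge0.
Qed.

Theorem proposition7 (R : realType) (p : R) (hp : 0 <= p <= 1) (hp1 : p != 1) :
  preserves_state_order (@imaginarity_l1 R 2) (@amplitude_damping R p).
Proof.
move=> rho1 rho2 D1 D2; rewrite !imaginarity_l1_amplitude_damping//.
(* Cancelling the factor in both directions needs it strictly positive; at [p = 1] every output
   would have imaginarity 0. *)
rewrite ler_pM2l// sqrtr_gt0 subr_gt0 lt_neqAle hp1.
by case/andP: hp.
Qed.
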